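(* Let $\mathcal{G}=([n],\mathcal{E},\mathcal{A})$, $n\ge2$, be a strongly connected directed weighted graph with loop-less Laplacian $\mathcal{L}$. Then there exists a positive diagonal matrix $M=\mathrm{diag}(m_1,\dots,m_n)$ such that for all distinct $a,b\in[n]$, $$R_{\mathcal{G}}(a,b)=m_a\,(e_a-e_b)^\top(M\mathcal{L})^\dagger(e_a-e_b),$$ where $(M\mathcal{L})^\dagger$ is the Moore–Penrose pseudoinverse and $e_a$ is the $a$-th standard basis vector.
   Context: A directed weighted graph $\mathcal{G}=([n],\mathcal{E},\mathcal{A})$ has node set $[n]$ and weighted adjacency matrix $\mathcal{A}\in\mathbb{R}^{n\times n}$ with nonnegative entries; for $i\neq j$, $\mathcal{A}_{ij}>0$ means an edge from $i$ to $j$. It is strongly connected if there is a directed path from every node to every other node. The degree matrix is $\mathcal{D}=\mathrm{diag}(\sum_j\mathcal{A}_{ij})_i$ and the loop-less Laplacian is $\mathcal{L}=\mathcal{D}-\mathcal{A}$. For $\beta\subseteq[n]$, $\beta^c=[n]\setminus\beta$, $M[\beta,\gamma]$ is a submatrix, and $M/M[\beta^c,\beta^c]=M[\beta,\beta]-M[\beta,\beta^c]M[\beta^c,\beta^c]^{-1}M[\beta^c,\beta]$ (with $M/M[\emptyset,\emptyset]=M$). For distinct $a,b$, the effective conductance from $a$ to $b$ is $C_{\mathcal{G}}(a,b)=(\mathcal{L}/\mathcal{L}[\{a,b\}^c,\{a,b\}^c])_{aa}$ and the effective resistance is $R_{\mathcal{G}}(a,b)=1/C_{\mathcal{G}}(a,b)$.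 *)

(* Defs.v *)
From HB Require Import structures.
From mathcomp Require Import all_boot all_order all_algebra.
From mathcomp Require Import reals.

Set Implicit Arguments.
Unset Strict Implicit.
Unset Printing Implicit Defensive.

Import Order.TTheory GRing.Theory Num.Theory.
Local Open Scope ring_scope.

Section Graph.
Variables (R : realFieldType) (n : nat).

(* The edge set is determined by the adjacency matrix, see [edge]. *)
Record wdigraph := WDigraph {
  adj : 'M[R]_n;
  adj_ge0 : forall i j, 0 <= adj i j }.

Definition edge (G : wdigraph) : rel 'I_n :=
  [rel i j | (i != j) && (0 < adj G i j)].

Definition strongly_connected (G : wdigraph) : Prop :=
  forall i j, i != j -> connect (edge G) i j.

(* A loop A_ii contributes to both terms, so it cancels in the Laplacian. *)
Definition degree_mx (G : wdigraph) : 'M[R]_n :=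
  diag_mx (\row_i \sum_j adj G i j).

Definition laplacian (G : wdigraph) : 'M[R]_n := degree_mx G - adj G.

End Graph.

Section Schur.
Variables (R : realFieldType) (n : nat).

(* M[beta, gamma], with rows and columns listed in increasing order. *)
Definition set_submx (beta gamma : {set 'I_n}) (M : 'M[R]_n) :
    'M[R]_(#|beta|, #|gamma|) :=
  mxsub enum_val enum_val M.

(* M / M[beta^c, beta^c] *)
Definition schur_compl (beta : {set 'I_n}) (M : 'M[R]_n) : 'M[R]_#|beta| :=
  set_submx beta beta M
  - set_submx beta (~: beta) M
    *m invmx (set_submx (~: beta) (~: beta) M)
    *m set_submx (~: beta) beta M.

(* [enum_rank_in (set21 a b) a] is the position of [a] in [set a; b]. *)
Definition eff_conductance (G : wdigraph R n) (a b : 'I_n) : R :=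
  schur_compl [set a; b] (laplacian G)
    (enum_rank_in (set21 a b) a) (enum_rank_in (set21 a b) a).

Definition eff_resistance (G : wdigraph R n) (a b : 'I_n) : R :=
  (eff_conductance G a b)^-1.

End Schur.

Section MoorePenrose.
Variable R : realFieldType.

Definition is_mpinv m n (A : 'M[R]_(m, n)) (X : 'M[R]_(n, m)) : bool :=
  [&& A *m X *m A == A, X *m A *m X == X,
      (A *m X)^T == A *m X & (X *m A)^T == X *m A].

Lemma is_mpinv_inj m n (A : 'M[R]_(m, n)) X Y :
  is_mpinv A X -> is_mpinv A Y -> X = Y.
Proof.
move=> /and4P[/eqP AXA /eqP XAX /eqP AXt /eqP XAt].
move=> /and4P[/eqP AYA /eqP YAY /eqP AYt /eqP YAt].
have eqA : A *m X = A *m Y.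
  rewrite -AXt -{1}AYA -(mulmxA (A *m Y) A X) trmx_mul AXt AYt.
  by rewrite mulmxA AXA.
have eqB : X *m A = Y *m A.
  rewrite -XAt -{1}AYA (mulmxA X (A *m Y) A) (mulmxA X A Y).
  rewrite -(mulmxA (X *m A) Y A) trmx_mul XAt YAt.
  by rewrite -mulmxA (mulmxA A X A) AXA.
by rewrite -XAX eqB -mulmxA eqA mulmxA YAY.
Qed.

Lemma gram_unitmx m n (F : 'M[R]_(m, n)) : row_free F -> F *m F^T \in unitmx.
Proof.
move=> freeF; rewrite -row_free_unit -kermx_eq0; apply/rowV0P => u /sub_kermxP.
move=> uFF; have /eqP : (u *m F *m (u *m F)^T) 0 0 = 0.
  by rewrite trmx_mul mulmxA -(mulmxA u) uFF mul0mx mxE.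
rewrite mxE psumr_eq0 => [|i _]; last by rewrite [_^T _ _]mxE -expr2 sqr_ge0.
move=> /allP uF0; apply: (row_free_inj freeF); rewrite mul0mx.
apply/rowP => i; move: (uF0 i (mem_index_enum i)).
by rewrite [_^T _ _]mxE mulf_eq0 orbb [RHS]mxE => /eqP.
Qed.

Lemma mpinv_exists m n (A : 'M[R]_(m, n)) : exists X, is_mpinv A X.
Proof.
have [r [C [F [CF fC fF]]]] : exists r (C : 'M[R]_(m, r)) (F : 'M[R]_(r, n)),
    [/\ C *m F = A, row_free C^T & row_free F].
  exists (\rank A), (col_base A), (row_base A).
  split; [exact: mulmx_base | | exact: row_base_free].
  by rewrite /row_free mxrank_tr; apply: col_base_full.
pose P := F *m F^T; pose Q := C^T *m C.
have uP : P \in unitmx by apply: gram_unitmx.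
have uQ : Q \in unitmx.
  by have := gram_unitmx fC; rewrite trmxK.
have Pt : P^T = P by rewrite trmx_mul trmxK.
have Qt : Q^T = Q by rewrite trmx_mul trmxK.
pose X := F^T *m invmx P *m (invmx Q *m C^T).
have AX : A *m X = C *m invmx Q *m C^T.
  rewrite -CF /X !mulmxA -(mulmxA C F) -/P -(mulmxA C P).
  by rewrite mulmxV // mulmx1.
have XA : X *m A = F^T *m invmx P *m F.
  rewrite -CF /X !mulmxA -(mulmxA _ C^T C) -/Q.
  by rewrite -(mulmxA _ (invmx Q) Q) mulVmx // mulmx1.
exists X; apply/and4P; split; apply/eqP.
- rewrite AX -CF !mulmxA -(mulmxA _ C^T C) -/Q -(mulmxA C) mulVmx //.
  by rewrite mulmx1.
- rewrite XA /X !mulmxA -(mulmxA _ F F^T) -/P.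
  by rewrite -(mulmxA _ (invmx P) P) mulVmx // mulmx1.
- by rewrite AX !trmx_mul trmxK trmx_inv Qt mulmxA.
- by rewrite XA !trmx_mul trmxK trmx_inv Pt mulmxA.
Qed.

(* Not [pinvmx], which is only a generalized inverse. *)
Definition mpinv m n (A : 'M[R]_(m, n)) : 'M[R]_(n, m) :=
  xchoose (mpinv_exists A).

Lemma mpinvP m n (A : 'M[R]_(m, n)) : is_mpinv A (mpinv A).
Proof. exact: xchooseP. Qed.

Definition std_basis n (a : 'I_n) : 'cV[R]_n := delta_mx a 0.

End MoorePenrose.

Arguments std_basis {R n} a.

(* Main.v *)
Require Import Defs.
From HB Require Import structures.
From mathcomp Require Import all_boot all_order all_algebra.
From mathcomp Require Import reals.

Set Implicit Arguments.
Unset Strict Implicit.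
Unset Printing Implicit Defensive.

Import Order.TTheory GRing.Theory Num.Theory.
Local Open Scope ring_scope.

(** Take for [m] a positive left null vector of the Laplacian [L] and put
    [N = M L], so that the rows and the columns of [N] both sum to zero.
    The maximum principle gives a potential [v] with [v_a = 1], [v_b = 0] that
    is harmonic off [{a, b}]; by the Schur formula [(L v)_a = C(a, b)].  Hence
    [N v] is supported on [{a, b}] and sums to zero, i.e.
    [N v = m_a C(a, b) (e_a - e_b)].  Since [N N^+ N = N] and [ker N] consists
    of the constants, [N^+ N v - v] is constant, so
    [m_a C(a, b) (e_a - e_b)^T N^+ (e_a - e_b) = v_a - v_b = 1]. *)

(** * Schur complements through harmonic extension *)

Section SchurHarmonic.
Variables (R : realFieldType) (n : nat).
Implicit Types (beta gamma : {set 'I_n}) (M : 'M[R]_n).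

(** Turns submatrices into matrix products, so that block computations become plain matrix algebra;
    its transpose extends a vector on [beta] by zero. *)
Definition restr_mx beta : 'M[R]_(#|beta|, n) := rowsub enum_val 1%:M.

Lemma restr_mxE beta m (X : 'M[R]_(n, m)) k j :
  (restr_mx beta *m X) k j = X (enum_val k) j.
Proof. by rewrite mul_rowsub_mx mul1mx mxE. Qed.

Lemma set_submxE beta gamma M :
  set_submx beta gamma M = restr_mx beta *m M *m (restr_mx gamma)^T.
Proof.
apply/matrixP => i j; rewrite -[_ *m _^T]trmxK [RHS]mxE.
by rewrite trmx_mul trmxK restr_mxE [RHS]mxE restr_mxE mxE.
Qed.

Lemma restr_mx_tr beta : restr_mx beta *m (restr_mx beta)^T = 1%:M.
Proof.
apply/matrixP => i j; rewrite restr_mxE !mxE.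
by rewrite (inj_eq enum_val_inj) eq_sym.
Qed.

Lemma restr_mx_trC beta : restr_mx beta *m (restr_mx (~: beta))^T = 0.
Proof.
apply/matrixP => i j; rewrite restr_mxE !mxE.
have := enum_valP j; rewrite inE; case: eqP => // ->.
by rewrite enum_valP.
Qed.

Lemma restr_mxC_tr beta : restr_mx (~: beta) *m (restr_mx beta)^T = 0.
Proof. by apply: trmx_inj; rewrite trmx_mul trmxK restr_mx_trC trmx0. Qed.

Lemma restr_mx_inj beta m (X Y : 'M[R]_(n, m)) :
  restr_mx beta *m X = restr_mx beta *m Y ->
  restr_mx (~: beta) *m X = restr_mx (~: beta) *m Y -> X = Y.
Proof.
have E gamma i j : restr_mx gamma *m X = restr_mx gamma *m Y ->
    i \in gamma -> X i j = Y i j.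
  move=> eqXY ig; move/matrixP/(_ (enum_rank_in ig i) j): eqXY.
  by rewrite !restr_mxE enum_rankK_in.
move=> eqb eqc; apply/matrixP => i j; case: (boolP (i \in beta)) => ib.
  exact: E eqb ib.
by apply: E eqc _; rewrite inE.
Qed.

(* The columns extend the unit vectors of [beta] harmonically off [beta]. *)
Definition harmonic_ext beta M : 'M[R]_(n, #|beta|) :=
  (restr_mx beta)^T - (restr_mx (~: beta))^T
    *m (invmx (set_submx (~: beta) (~: beta) M) *m set_submx (~: beta) beta M).

Lemma restr_harmonic_ext beta M :
  restr_mx beta *m harmonic_ext beta M = 1%:M.
Proof.
by rewrite mulmxBr mulmxA restr_mx_trC mul0mx subr0 restr_mx_tr.
Qed.

(** On the rows of [beta] the product is the Schur complement by definition; on the other rows the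
    correction term cancels [M[beta^c, beta]]. *)
Lemma mulmx_harmonic_ext beta M :
    set_submx (~: beta) (~: beta) M \in unitmx ->
  M *m harmonic_ext beta M = (restr_mx beta)^T *m schur_compl beta M.
Proof.
move=> uM; apply: (@restr_mx_inj beta).
  rewrite (mulmxA _ _ (schur_compl _ _)) restr_mx_tr mul1mx.
  by rewrite !mulmxBr !mulmxA -!set_submxE.
have -> : restr_mx (~: beta) *m ((restr_mx beta)^T *m schur_compl beta M) = 0.
  by rewrite mulmxA restr_mxC_tr mul0mx.
by rewrite !mulmxBr !mulmxA -!set_submxE mulmxV // mul1mx subrr.
Qed.

End SchurHarmonic.

(** * Maximum principle and null vectors of the Laplacian *)

Section Laplacian.
Variables (R : realFieldType) (n : nat) (G : wdigraph R n).
Local Notation L := (laplacian G).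

Lemma laplacian_mulE (x : 'cV[R]_n) i :
  (L *m x) i 0 = \sum_j adj G i j * (x i 0 - x j 0).
Proof.
rewrite mulmxBl mxE mul_diag_mx !mxE mulr_suml -sumrB.
by apply: eq_bigr => j _; rewrite mulrBr.
Qed.

Lemma mul_laplacianE (x : 'rV[R]_n) j :
  (x *m L) 0 j = x 0 j * (\sum_k adj G j k) - \sum_i x 0 i * adj G i j.
Proof. by rewrite mulmxBr mxE mul_mx_diag !mxE. Qed.

Lemma laplacian_const : L *m const_mx 1 = 0 :> 'cV_n.
Proof.
apply/colP => i; rewrite laplacian_mulE !mxE big1 // => j _.
by rewrite !mxE subrr mulr0.
Qed.

Hypothesis hG : strongly_connected G.

(** Induction along a path; strong connectivity enters the arguments below in this form. *)
Lemma edge_closed_all (P : pred 'I_n) i0 :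
  P i0 -> (forall i j, P i -> edge G i j -> P j) -> forall j, P j.
Proof.
move=> Pi0 Pcl j; case: (eqVneq i0 j) => [<- //|/hG /connectP[p]].
elim: p i0 Pi0 => [|k p IHp] i Pi /= => [_ -> //|/andP[ik pk]].
exact: IHp (Pcl _ _ Pi ik) pk.
Qed.

(** If [beta] missed the maximum, harmonicity at a maximal node would make its out-neighbours
    maximal, and the maximum would spread to [b]. *)
Lemma harmonic_max (beta : {set 'I_n}) (x : 'cV[R]_n) i0 b :
    b \in beta -> (forall i, i \notin beta -> (L *m x) i 0 = 0) ->
  (forall i, x i 0 <= x i0 0) -> exists2 s, s \in beta & x s 0 = x i0 0.
Proof.
move=> bB hx xmax.
have [/existsP[s /andP[sB /eqP xs]]|nex] :=
  boolP [exists s, (s \in beta) && (x s 0 == x i0 0)]; first by exists s.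
suff allmax : forall j, x j 0 == x i0 0 by exists b => //; apply/eqP.
apply: (@edge_closed_all _ i0) => // i j /eqP xi /andP[_ Aij].
have iB : i \notin beta.
  by apply: contra nex => iB; apply/existsP; exists i; rewrite iB xi /=.
(* At a maximal node all terms [A_ik (x_i - x_k)] are nonnegative and sum to zero, so each of them
   vanishes. *)
move/eqP: (hx _ iB); rewrite laplacian_mulE psumr_eq0; last first.
  by move=> k _; rewrite mulr_ge0 ?adj_ge0 // xi subr_ge0.
move=> /allP/(_ j (mem_index_enum _)); rewrite mulf_eq0 gt_eqF //= xi.
by rewrite subr_eq0 eq_sym.
Qed.

Lemma harmonic_le0 (beta : {set 'I_n}) (x : 'cV[R]_n) b :
    b \in beta -> (forall i, i \notin beta -> (L *m x) i 0 = 0) ->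
  (forall i, i \in beta -> x i 0 = 0) -> forall i, x i 0 <= 0.
Proof.
move=> bB hx x0 i.
case: (@arg_maxP _ _ _ b predT (fun i => x i 0)) => // i0 _ xmax.
have [s sB xs] := harmonic_max bB hx (i0 := i0) (fun j => xmax j isT).
by rewrite -(x0 _ sB) xs; apply: xmax.
Qed.

Lemma harmonic_eq0 (beta : {set 'I_n}) (x : 'cV[R]_n) b :
    b \in beta -> (forall i, i \notin beta -> (L *m x) i 0 = 0) ->
  (forall i, i \in beta -> x i 0 = 0) -> x = 0.
Proof.
move=> bB hx x0; apply/colP => i; rewrite mxE; apply/eqP.
rewrite eq_le (harmonic_le0 bB hx x0) /= -oppr_le0.
have := @harmonic_le0 beta (- x) b bB _ _ i; rewrite mxE; apply.
  by move=> j jB; rewrite mulmxN mxE hx // oppr0.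
by move=> j jB; rewrite mxE x0 // oppr0.
Qed.

(** Subtracting the constant [x_j] leaves a vector that is harmonic everywhere and zero at [j]. *)
Lemma laplacian_ker (x : 'cV[R]_n) : L *m x = 0 -> forall i j, x i 0 = x j 0.
Proof.
move=> Lx i j; pose y := x - x j 0 *: const_mx 1.
have y0 : y = 0.
  apply: (@harmonic_eq0 [set j] y j); rewrite ?set11 // => k.
    by rewrite mulmxBr -scalemxAr laplacian_const scaler0 Lx subr0 mxE.
  by rewrite inE => /eqP ->; rewrite !mxE mulr1 subrr.
move/colP/(_ i): y0; rewrite !mxE mulr1 => /eqP.
by rewrite subr_eq0 => /eqP.
Qed.

(** A kernel vector of the block, extended by zero to [beta], is harmonic off [beta], hence zero. *)
Lemma laplacian_submx_unit (beta : {set 'I_n}) b :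
  b \in beta -> set_submx (~: beta) (~: beta) L \in unitmx.
Proof.
move=> bB; rewrite -unitmx_tr -row_free_unit -kermx_eq0.
apply/rowV0P => u /sub_kermxP uL; apply: trmx_inj.
pose x : 'cV_n := (restr_mx R (~: beta))^T *m u^T.
have x0 : x = 0.
  have Lx : restr_mx R (~: beta) *m (L *m x) = 0.
    by rewrite /x !mulmxA -set_submxE -[LHS]trmxK trmx_mul trmxK uL trmx0.
  apply: (harmonic_eq0 bB) => i iB.
    have iC : i \in ~: beta by rewrite inE.
    move/matrixP/(_ (enum_rank_in iC i) 0): Lx.
    by rewrite restr_mxE enum_rankK_in // => ->; rewrite mxE.
  have : restr_mx R beta *m x = 0 by rewrite mulmxA restr_mx_trC mul0mx.
  move/matrixP/(_ (enum_rank_in iB i) 0).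
  by rewrite restr_mxE enum_rankK_in // => ->; rewrite mxE.
by rewrite trmx0 -[u^T]mul1mx -restr_mx_tr -mulmxA -/x x0 mulmx0.
Qed.

(* If [x L = 0], the triangle inequality gives [|x| L <= 0] entrywise; as the
   entries of [|x| L] sum to zero, [|x|] is again a left null vector. *)
Lemma laplacian_left_null : (0 < n)%N ->
  exists2 m : 'rV[R]_n, forall i, 0 < m 0 i & m *m L = 0.
Proof.
(* The constants lie in the right kernel, so [L] is singular and also has a nonzero left null
   vector. *)
move=> n0; have : ~~ row_free L.
  rewrite row_free_unit -unitmx_tr -row_free_unit -kermx_eq0.
  apply/rowV0Pn; exists (const_mx 1).
    by apply/sub_kermxP; rewrite -trmx_const -trmx_mul laplacian_const trmx0.
  by apply/eqP => /rowP/(_ (Ordinal n0))/eqP; rewrite !mxE oner_eq0.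
rewrite -kermx_eq0 => /rowV0Pn[x /sub_kermxP xL x0].
pose m : 'rV[R]_n := map_mx Num.norm x.
have mL_le0 j : (m *m L) 0 j <= 0.
  rewrite mul_laplacianE subr_le0 mxE.
  have d0 : 0 <= \sum_k adj G j k by apply: sumr_ge0 => k _; apply: adj_ge0.
  rewrite -(ger0_norm d0) -normrM.
  have /rowP/(_ j)/eqP := xL; rewrite mul_laplacianE mxE subr_eq0 => /eqP ->.
  apply: le_trans (ler_norm_sum _ _ _) _; apply: ler_sum => i _.
  by rewrite mxE normrM (ger0_norm (adj_ge0 G i j)).
have mL0 : m *m L = 0.
  have sum0 : \sum_j - (m *m L) 0 j = 0.
    have : (m *m (L *m const_mx 1 : 'cV_n)) 0 0 = 0.
      by rewrite laplacian_const mulmx0 mxE.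
    rewrite mulmxA mxE => s0; apply/eqP; rewrite sumrN oppr_eq0 -{2}s0.
    apply/eqP.
    by apply: eq_bigr => j _; rewrite [const_mx _ _ _]mxE mulr1.
  apply/rowP => j; rewrite [RHS]mxE; apply/eqP; rewrite -oppr_eq0.
  move/eqP: sum0; rewrite psumr_eq0; last by move=> k _; rewrite oppr_ge0.
  by move=> /allP/(_ j (mem_index_enum _)).
have [i0 xi0] : exists i0, x 0 i0 != 0.
  apply/existsP; apply: contraNT x0; rewrite negb_exists => /forallP x0.
  by apply/eqP/rowP => i; rewrite mxE; apply/eqP/negPn.
(* Positivity spreads along edges: if [m_j = 0], column [j] of [m L = 0] says that the nonnegative
   terms [m_i A_ij] sum to zero, so [m_i = 0] for every edge from [i] to [j]. *)
exists m => //; apply: (@edge_closed_all (fun i => 0 < m 0 i) i0).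
  by rewrite mxE normr_gt0.
move=> i j mi /andP[_ Aij]; rewrite lt0r.
have -> : 0 <= m 0 j by rewrite mxE normr_ge0.
rewrite andbT.
apply: contraTneq mi => mj0; rewrite -leNgt.
have /rowP/(_ j)/eqP := mL0; rewrite mul_laplacianE mj0 mul0r sub0r mxE.
rewrite oppr_eq0 psumr_eq0; last first.
  by move=> k _; rewrite mxE mulr_ge0 ?adj_ge0.
move=> /allP/(_ i (mem_index_enum _)); rewrite mulf_eq0 (gt_eqF Aij) orbF.
by move=> /eqP ->.
Qed.

(** The potential is the column of the harmonic extension at [a]; applying [L] yields the matching
    column of the Schur complement. *)
Lemma conductance_potential a b : a != b ->
  exists v : 'cV[R]_n, [/\ v a 0 = 1, v b 0 = 0,
    (L *m v) a 0 = eff_conductance G a b &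
    forall i, i != a -> i != b -> (L *m v) i 0 = 0].
Proof.
move=> ab; pose beta := [set a; b].
pose aB : a \in beta := set21 a b.
have bB : b \in beta := set22 a b.
pose ka := enum_rank_in aB a; pose H := harmonic_ext beta L.
have HE i (iB : i \in beta) : H i ka = (i == a)%:R.
  rewrite -[in LHS](enum_rankK_in iB iB) -restr_mxE restr_harmonic_ext mxE.
  by rewrite -(inj_eq enum_val_inj) !enum_rankK_in.
have LH i : (L *m col ka H) i 0
    = ((restr_mx R beta)^T *m schur_compl beta L) i ka.
  rewrite colE mulmxA -colE mxE.
  by rewrite (mulmx_harmonic_ext (laplacian_submx_unit aB)).
exists (col ka H); rewrite LH [col ka H a 0]mxE [col ka H b 0]mxE !HE // eqxx.
rewrite eq_sym (negPf ab); split=> // [|i ia ib]; last first.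
  have iC : i \in ~: beta by rewrite !inE negb_or ia ib.
  rewrite LH -[i](enum_rankK_in iC iC) -restr_mxE mulmxA restr_mxC_tr.
  by rewrite mul0mx mxE.
have := restr_mxE ((restr_mx R beta)^T *m schur_compl beta L) ka ka.
by rewrite mulmxA restr_mx_tr mul1mx enum_rankK_in // => <-.
Qed.

End Laplacian.

Theorem theorem4p14 (R : realType) (n : nat) (hn : (2 <= n)%N)
    (G : wdigraph R n) (hG : strongly_connected G) :
  exists m : 'rV[R]_n,
    (forall i : 'I_n, 0 < m 0 i) /\
    forall a b : 'I_n, a != b ->
      eff_resistance G a b =
        m 0 a * ((std_basis a - std_basis b)^T
                  *m mpinv (diag_mx m *m laplacian G)
                  *m (std_basis a - std_basis b)) 0 0.
Proof.
have [m m_gt0 mL] := laplacian_left_null hG (ltnW hn).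
exists m; split=> // a b ab; rewrite /eff_resistance.
have [v [va vb <- vh]] := conductance_potential hG ab.
set C := (_ *m v) a 0; set e := _ - _; set N := _ *m laplacian G.
set q := (_ *m _) 0 0.
have Nv : N *m v = (m 0 a * C) *: e.
  have NE i : (N *m v) i 0 = m 0 i * (laplacian G *m v) i 0.
    by rewrite -mulmxA mul_diag_mx mxE.
  (* The sum equals [m L v]; it determines the entry at [b] from the one at [a]. *)
  have sum0 : \sum_i (N *m v) i 0 = 0.
    have : (m *m laplacian G *m v) 0 0 = 0 by rewrite mL mul0mx mxE.
    rewrite -mulmxA mxE => s0; rewrite -[RHS]s0.
    by apply: eq_bigr => i _; rewrite NE.
  move: sum0; rewrite (bigD1 a) //= (bigD1 b) /=; last by rewrite eq_sym.
  rewrite big1 ?addr0 => [|i /andP[ia ib]]; last by rewrite NE vh // mulr0.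
  move=> /eqP; rewrite addrC addr_eq0 => /eqP Nb; apply/colP => i.
  have ei : e i 0 = (i == a)%:R - (i == b)%:R by rewrite !mxE !andbT.
  rewrite [RHS]mxE ei.
  case: (eqVneq i a) => [->|ia]; first by rewrite (negPf ab) subr0 mulr1 NE.
  case: (eqVneq i b) => [->|ib]; first by rewrite sub0r mulrN1 Nb NE.
  by rewrite NE vh // subrr !mulr0.
have NPN : N *m mpinv N *m N = N by have /and4P[/eqP] := mpinvP N.
(* Row scaling by the positive [m_i] does not change the kernel. *)
have kerN (x : 'cV[R]_n) : N *m x = 0 -> laplacian G *m x = 0.
  rewrite -mulmxA mul_diag_mx => /colP N0; apply/colP => i; apply/eqP.
  move: (N0 i) => /eqP; rewrite mxE ![(0 : 'cV_n) i 0]mxE mulf_eq0.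
  by rewrite (gt_eqF (m_gt0 i)).
have LP : laplacian G *m (mpinv N *m N *m v - v) = 0.
  by apply: kerN; rewrite mulmxBr (mulmxA N) (mulmxA N) NPN subrr.
have Cq : m 0 a * C * q = 1.
  have eE (x : 'cV[R]_n) : (e^T *m x) 0 0 = x a 0 - x b 0.
    by rewrite /e /std_basis linearB /= !trmx_delta mulmxBl -!rowE !mxE.
  have -> : m 0 a * C * q = (e^T *m (mpinv N *m N *m v)) 0 0.
    by rewrite -(mulmxA (mpinv N)) Nv -!scalemxAr mxE (mulmxA e^T).
  move: (laplacian_ker hG LP a b); rewrite eE.
  set w := _ *m v; rewrite mxE [X in w a 0 + X]mxE va => /eqP.
  rewrite [X in _ == X]mxE [X in _ == _ + X]mxE vb subr0.
  by rewrite subr_eq addrC => /eqP ->; rewrite addrK.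
(* The identity just proved also shows that [C^-1] is a genuine inverse and not the default value at
   zero. *)
have C0 : C != 0.
  by apply: contra_eq_neq Cq => ->; rewrite mulr0 mul0r eq_sym oner_eq0.
by apply: (mulfI C0); rewrite mulfV // mulrA (mulrC C).
Qed.
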